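(* Let $u_i:B_1\to N\subset\mathbb R^p$ be a sequence of weakly conformal harmonic maps with uniformly bounded energy satisfying (i)-(iii) of the context, and let $a_\infty,b_\infty,c_\infty,d_\infty,q_\infty$ be the coefficients of the limit map $$v_\infty(s,\theta)= q_\infty s + a_\infty e^s \cos\theta + b_\infty e^s \sin\theta + c_\infty e^{-s}\cos \theta + d_\infty e^{-s}\sin \theta$$ described in the context. Assume that $\dim N=3$ and $$\left(|a_\infty|^2+|b_\infty|^2\right)\left(|c_\infty|^2+|d_\infty|^2\right)\neq0.$$ Then the planes spanned by $(a_\infty,b_\infty)$ and by $(c_\infty,d_\infty)$ are the same (modulo orientation). Moreover, if $q_\infty=0$, the orientations given by the ordered bases $(a_\infty,b_\infty)$ and $(c_\infty,d_\infty)$ are opposite; and if $q_\infty\neq0$, one must have $a_\infty=\lambda c_\infty$ and $b_\infty=\lambda d_\infty$ for some $\lambda>0$, in which case the surface parametrized by $v_\infty$ is the catenoid (up to similarity).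
   Context: $B_r\subset\mathbb R^2$ is the ball of radius $r$ centered at the origin, with the flat metric. $N$ is a closed Riemannian manifold isometrically embedded in $\mathbb R^p$; maps into $N$ are regarded as $\mathbb R^p$-valued. Harmonic maps are (smooth) critical points of $E(u)=\frac12\int|\nabla u|^2$. A map $u$ is weakly conformal if $|\partial_{x_1}u|=|\partial_{x_2}u|$ and $\partial_{x_1}u\cdot\partial_{x_2}u=0$ everywhere. On $B_1\setminus\{0\}$ use polar coordinates $(r,\theta)$ and cylinder coordinates $(t,\theta)$ with $t=\log r$; $u_i(t,\theta)$ means $u_i$ in these coordinates. Assumptions on the sequence $u_i:B_1\to N$ (harmonic, $\sup_iE(u_i)<\infty$): (i) $u_i$ converges locally smoothly in $\overline{B}_1\setminus\{0\}$ to a limit map $u_\infty$, which (removable singularity theorem) extends to a smooth harmonic map $B_1\to N$; (ii) there is a sequence $\lambda_i>0$, $\lambda_i\to0$, such that $u_i(\lambda_i y)$ converges locally smoothly on $\mathbb R^2$ to a bubble map $\omega:\mathbb R^2\to N$ (a nonconstant harmonic map of finite energy); (iii) $\omega$ is the only bubble: whenever, along a subsequence, $x_i\to 0$ and $\mu_i\to 0^+$ are such that $u_i(x_i+\mu_i y)$ converges locally smoothly on $\mathbb R^2$ minus a finite set to a nonconstant map, the quantity $\frac{\lambda_i}{\mu_i}+\frac{\mu_i}{\lambda_i}+\frac{|x_i|}{\lambda_i+\mu_i}$ is bounded along that subsequence. Neck expansion: $p_i,q_i,a_i,b_i,c_i,d_i\in\mathbb R^p$ are uniformly bounded coefficients such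 that, for a small fixed $\delta\in(0,1)$ and any $\alpha\in(0,1)$, for $t\in[\log(\lambda_i/\delta),\log\delta]$, $$u_i= p_i + q_i t + a_{i} e^t\cos \theta + b_{i} e^t\sin \theta + c_{i} \lambda_i e^{-t}\cos \theta + d_{i} \lambda_i e^{-t}\sin \theta + O(\eta^{1+\alpha}),\qquad \eta=e^t+\lambda_ie^{-t},$$ with $O(\eta^{1+\alpha})$ bounded by $C\eta^{1+\alpha}$, $C$ independent of $i$, and $\left||q_i|^2-2\lambda_i(a_i\cdot c_i+b_i\cdot d_i)\right|\le C\lambda_i^{1+\alpha/2}$. (The paper proves such coefficients exist.) The limit map: $v_\infty$ is the limit, in the sense of local smooth convergence on $\mathbb R\times S^1$ along a subsequence (which the paper proves exists and has the displayed form), of $$v_i(s,\theta)=\frac{1}{\sqrt{\lambda_i}}\left(u_i\left(s+\tfrac12\log\lambda_i,\theta\right)-\left(p_i+\tfrac12 q_i\log\lambda_i\right)\right).$$ Here $a_\infty,b_\infty\in\mathbb R^p$ are given by $u_\infty(x)=p_\infty+a_\infty x_1+b_\infty x_2+o(|x|)$ as $x\to0$, and $c_\infty,d_\infty\in\mathbb R^p$ by $\tilde\omega(y)=p_\infty+c_\infty y_1+d_\infty y_2+o(|y|)$ as $y\to0$, where $\tilde\omega(y_1,y_2)=\omega\left(\frac{y_1}{|y|^2},\frac{y_2}{|y|^2}\right)$ (extended smoothly to the origin) and $p_\infty=u_\infty(0)=\tilde\omega(0)$; $q_\infty\in\mathbb R^p$ is the remaining coefficient of $v_\infty$. All of $a_\infty,b_\infty,c_\infty,d_\infty,q_\infty$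 lie in the tangent space $T_{p_\infty}N$. *)

(* Defs.v *)
From HB Require Import structures.
From mathcomp Require Import all_boot all_order all_algebra.
From mathcomp Require Import all_classical all_reals all_analysis.
Set Implicit Arguments.
Unset Strict Implicit.
Unset Printing Implicit Defensive.
Import Order.TTheory GRing.Theory Num.Theory.
Import numFieldNormedType.Exports.
Local Open Scope classical_set_scope.
Local Open Scope ring_scope.

(* The library norm on ['rV_p] and on products is the sup norm; lengths and
   angles in the geometric statements use the Euclidean structure below. *)
Definition dot (R : realType) (p : nat) (v w : 'rV[R]_p) : R :=
  \sum_(j < p) v 0 j * w 0 j.

Definition enorm (R : realType) (p : nat) (v : 'rV[R]_p) : R :=
  Num.sqrt (dot v v).

Definition enorm2 (R : realType) (x : R * R) : R :=
  Num.sqrt (x.1 ^+ 2 + x.2 ^+ 2).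

Definition disk (R : realType) (r : R) : set (R * R) :=
  [set x | enorm2 x < r].

Definition iter_derive (R : realType) (V W : normedModType R)
    (s : seq V) (f : V -> W) : V -> W :=
  foldr (fun v g => 'D_v g) f s.

Definition smooth_on (R : realType) (V W : normedModType R)
    (U : set V) (f : V -> W) : Prop :=
  forall (s : seq V) (x : V), U x -> differentiable (iter_derive s f) x.

(* Local smooth convergence "in E" of maps defined on the open set U, where
   U `<=` E `<=` closure U: all derivatives converge uniformly on K `&` U for
   every compact K contained in E.  For E = U this is convergence in
   C^infty_loc(U); a larger E asks for uniformity up to the part of the
   boundary of U lying in E. *)
Definition cvg_smooth (R : realType) (V W : normedModType R)
    (U E : set V) (f : nat -> V -> W) (g : V -> W) : Prop :=
  smooth_on U g /\
  forall (s : seq V) (K : set V), compact K -> K `<=` E ->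
    {uniform K `&` U, (fun i => iter_derive s (f i)) @ \oo --> iter_derive s g}.

(* N is an n-dimensional embedded smooth submanifold of R^p without boundary
   (slice charts); its metric is the one induced from R^p. *)
Definition submanifold (R : realType) (p n : nat) (N : set 'rV[R]_p) : Prop :=
  (n <= p)%N /\
  forall x, N x ->
    exists (U V : set 'rV[R]_p) (Phi Psi : 'rV[R]_p -> 'rV[R]_p),
      [/\ open U, U x, open V, smooth_on U Phi & smooth_on V Psi] /\
      [/\ forall y, U y -> V (Phi y) /\ Psi (Phi y) = y,
          forall z, V z -> U (Psi z) /\ Phi (Psi z) = z &
          forall y, U y ->
            (N y <-> forall j : 'I_p, (n <= j)%N -> Phi y 0 j = 0)].

Definition closed_submanifold (R : realType) (p n : nat) (N : set 'rV[R]_p) :=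
  compact N /\ submanifold n N.

Definition D1 (R : realType) (p : nat) (u : R * R -> 'rV[R]_p) :
    R * R -> 'rV[R]_p := 'D_((1, 0) : R * R) u.

Definition D2 (R : realType) (p : nat) (u : R * R -> 'rV[R]_p) :
    R * R -> 'rV[R]_p := 'D_((0, 1) : R * R) u.

Definition energy (R : realType) (p : nat) (U : set (R * R))
    (u : R * R -> 'rV[R]_p) : \bar R :=
  (\int[(@lebesgue_measure R \x @lebesgue_measure R)]_(x in U)
     (2^-1 * (enorm (D1 u x) ^+ 2 + enorm (D2 u x) ^+ 2))%:E)%E.

(* A variation of u through maps U -> N, smooth in (x, tau) jointly, that is
   constant in tau outside the compact subset K of U. *)
Definition smooth_variation (R : realType) (p : nat) (U K : set (R * R))
    (N : set 'rV[R]_p) (u : R * R -> 'rV[R]_p)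
    (h : R -> R * R -> 'rV[R]_p) : Prop :=
  exists2 e : R, 0 < e &
  [/\ smooth_on [set z : (R * R) * R | U z.1 /\ `|z.2| < e]
        (fun z : (R * R) * R => h z.2 z.1),
      forall tau x, `|tau| < e -> U x -> N (h tau x),
      forall x, U x -> h 0 x = u x &
      forall tau x, `|tau| < e -> U x -> ~ K x -> h tau x = u x].

(* As the variation is supported in K, it suffices to differentiate the energy
   over K, which is finite even if the energy over U is not. *)
Definition harmonic_map (R : realType) (p : nat) (U : set (R * R))
    (N : set 'rV[R]_p) (u : R * R -> 'rV[R]_p) : Prop :=
  [/\ smooth_on U u,
      forall x, U x -> N (u x) &
      forall (K : set (R * R)) (h : R -> R * R -> 'rV[R]_p),
        compact K -> K `<=` U -> smooth_variation U K N u h ->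
        is_derive (0 : R) 1 (fun tau : R => fine (energy K (h tau))) 0].

Definition weakly_conformal (R : realType) (p : nat) (U : set (R * R))
    (u : R * R -> 'rV[R]_p) : Prop :=
  forall x, U x ->
    enorm (D1 u x) = enorm (D2 u x) /\ dot (D1 u x) (D2 u x) = 0.

Definition nonconstant_on (T T' : Type) (U : set T) (f : T -> T') : Prop :=
  exists y z, [/\ U y, U z & f y <> f z].

(* x = e^t (cos theta, sin theta).  Maps on R x S^1 are represented by their
   2 pi-periodic lifts to R * R. *)
Definition cyl (R : realType) (z : R * R) : R * R :=
  (expR z.1 * cos z.2, expR z.1 * sin z.2).

Definition inversion (R : realType) (y : R * R) : R * R :=
  (y.1 / enorm2 y ^+ 2, y.2 / enorm2 y ^+ 2).

Definition subsequence (phi : nat -> nat) : Prop :=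
  {homo phi : i j / (i < j)%N}.

(* x, mu and the bounded quantity are indexed by the subsequence phi. *)
Definition only_bubble (R : realType) (p : nat) (u : nat -> R * R -> 'rV[R]_p)
    (lam : nat -> R) : Prop :=
  forall (phi : nat -> nat) (x : nat -> R * R) (mu : nat -> R)
         (S : set (R * R)) (g : R * R -> 'rV[R]_p),
    subsequence phi ->
    x @ \oo --> (0 : R * R) ->
    (forall i, 0 < mu i) -> mu @ \oo --> (0 : R) ->
    finite_set S ->
    nonconstant_on (~` S) g ->
    cvg_smooth (~` S) (~` S)
      (fun i (y : R * R) => u (phi i) (x i + mu i *: y)) g ->
    exists C : R, forall i,
      lam (phi i) / mu i + mu i / lam (phi i)
        + enorm2 (x i) / (lam (phi i) + mu i) <= C.

Definition neck_approx (R : realType) (p : nat) (lam : R)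
    (P Q a b c d : 'rV[R]_p) (t theta : R) : 'rV[R]_p :=
  P + t *: Q
    + (expR t * cos theta) *: a + (expR t * sin theta) *: b
    + (lam * expR (- t) * cos theta) *: c
    + (lam * expR (- t) * sin theta) *: d.

Definition neck_expansion (R : realType) (p : nat)
    (u : nat -> R * R -> 'rV[R]_p) (lam : nat -> R) (delta : R)
    (P Q a b c d : nat -> 'rV[R]_p) : Prop :=
  (exists M : R, forall i, [/\ enorm (P i) <= M, enorm (Q i) <= M &
    [/\ enorm (a i) <= M, enorm (b i) <= M,
        enorm (c i) <= M & enorm (d i) <= M]]) /\
  forall alpha : R, 0 < alpha < 1 ->
    exists C : R, forall i,
      (forall t theta : R, ln (lam i / delta) <= t <= ln delta ->
         enorm (u i (cyl (t, theta))
                - neck_approx (lam i) (P i) (Q i) (a i) (b i) (c i) (d i)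
                    t theta)
         <= C * (expR t + lam i * expR (- t)) `^ (1 + alpha)) /\
      `| enorm (Q i) ^+ 2 - 2 * lam i * (dot (a i) (c i) + dot (b i) (d i)) |
         <= C * lam i `^ (1 + alpha / 2).

Definition rescaled (R : realType) (p : nat) (u : R * R -> 'rV[R]_p) (lam : R)
    (P Q : 'rV[R]_p) (z : R * R) : 'rV[R]_p :=
  (Num.sqrt lam)^-1 *:
    (u (cyl (z.1 + 2^-1 * ln lam, z.2)) - (P + (2^-1 * ln lam) *: Q)).

Definition limit_map (R : realType) (p : nat) (q a b c d : 'rV[R]_p)
    (z : R * R) : 'rV[R]_p :=
  z.1 *: q
    + (expR z.1 * cos z.2) *: a + (expR z.1 * sin z.2) *: b
    + (expR (- z.1) * cos z.2) *: c + (expR (- z.1) * sin z.2) *: d.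

Definition expansion1 (R : realType) (p : nat) (f : R * R -> 'rV[R]_p)
    (P a b : 'rV[R]_p) : Prop :=
  (fun x : R * R => f x - (P + x.1 *: a + x.2 *: b)) =o_ (0 : R * R) id.

Definition opposite_orientation (R : realType) (p : nat)
    (a b c d : 'rV[R]_p) : Prop :=
  exists M : 'M[R]_2, col_mx c d = M *m col_mx a b /\ \det M < 0.

Definition catenoid (R : realType) : set 'rV[R]_3 :=
  range (fun z : R * R => \row_(j < 3)
    [:: (expR z.1 + expR (- z.1)) / 2 * cos z.2;
        (expR z.1 + expR (- z.1)) / 2 * sin z.2;
        z.1]`_j).

Definition similarity (R : realType) (m p : nat)
    (F : 'rV[R]_m -> 'rV[R]_p) : Prop :=
  exists2 rho : R, 0 < rho &
    forall x y, enorm (F x - F y) = rho * enorm (x - y).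

Definition catenoid_up_to_similarity (R : realType) (p : nat)
    (S : set 'rV[R]_p) : Prop :=
  exists2 F : 'rV[R]_3 -> 'rV[R]_p, similarity F & S = F @` @catenoid R.

(* Main.v *)
Require Import Defs.
From HB Require Import structures.
From mathcomp Require Import all_boot all_order all_algebra.
From mathcomp Require Import all_classical all_reals all_analysis.
From mathcomp Require Import ring lra.
Set Implicit Arguments.
Unset Strict Implicit.
Unset Printing Implicit Defensive.
Import Order.TTheory GRing.Theory Num.Theory.
Import numFieldNormedType.Exports.
Local Open Scope classical_set_scope.
Local Open Scope ring_scope.

(** Polar coordinates are conformal, so each rescaled map is weakly conformal,
    and weak conformality, which only involves first derivatives, passes to the
    limit map.  Along the ray theta = 0, with x = e^s, the s- and theta-derivatives
    of the limit map are
      [q + x a - c / x]   and   [x b + d / x],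
    and equating powers of x in the two conformality equations gives
    ([conformal_relations]): |a| = |b|, a.b = 0, |c| = |d|, c.d = 0,
    q orthogonal to a, b, c, d, a.d = b.c and |q|^2 = 2 (a.c + b.d).

    These vectors also lie in one 3-dimensional space, a tangent space of N
    ([tangent_limit]).  The rescaled maps magnify by 1 / sqrt(lambda_i) and
    converge, so a bounded part of the neck is mapped to a set of diameter of
    order sqrt(lambda_i); by compactness of N it accumulates at a point n of N.
    The derivatives of the rescaled maps are tangent to N at points tending to
    n, and tangency is a closed condition.  Hence any four of q, a, b, c, d are
    linearly dependent ([dependent4_tangent]).

    What remains is linear algebra.  If q = 0, pairing a dependence between
    a, b, c, d with each of them shows that |a|^2 |c|^2 = (a.c)^2 + (a.d)^2,
    which is equality in Bessel's inequality for c, and for d, against the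
    orthogonal pair (a, b).  So c and d lie in the plane of a and b, and their
    coordinates there have determinant -|c|^2 / |a|^2.  If q <> 0, a dependence
    between q, a, b, c cannot involve q, which again puts c in the plane of a and
    b, and likewise d; then the relations force a.d = 0 and a.c = b.d > 0, that is,
    a = l c and b = l d with l > 0.  A translation by (ln l) / 2 in s turns the
    limit map into the standard parametrization of the catenoid. *)

(** * The Euclidean product of row vectors *)

Lemma dotC (R : realType) (p : nat) (v w : 'rV[R]_p) : dot v w = dot w v.
Proof. by apply: eq_bigr => j _; rewrite mulrC. Qed.

Lemma dotDl (R : realType) (p : nat) (v v' w : 'rV[R]_p) :
  dot (v + v') w = dot v w + dot v' w.
Proof. by rewrite -big_split; apply: eq_bigr => j _; rewrite mxE mulrDl. Qed.

Lemma dotDr (R : realType) (p : nat) (v w w' : 'rV[R]_p) :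
  dot v (w + w') = dot v w + dot v w'.
Proof. by rewrite dotC dotDl !(dotC v). Qed.

Lemma dotZl (R : realType) (p : nat) (k : R) (v w : 'rV[R]_p) :
  dot (k *: v) w = k * dot v w.
Proof. by rewrite /dot mulr_sumr; apply: eq_bigr => j _; rewrite mxE mulrA. Qed.

Lemma dotZr (R : realType) (p : nat) (k : R) (v w : 'rV[R]_p) :
  dot v (k *: w) = k * dot v w.
Proof. by rewrite dotC dotZl dotC. Qed.

Lemma dotNl (R : realType) (p : nat) (v w : 'rV[R]_p) : dot (- v) w = - dot v w.
Proof. by rewrite -scaleN1r dotZl mulN1r. Qed.

Lemma dotNr (R : realType) (p : nat) (v w : 'rV[R]_p) : dot v (- w) = - dot v w.
Proof. by rewrite dotC dotNl dotC. Qed.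

Definition dotE := (dotDl, dotDr, dotZl, dotZr, dotNl, dotNr).

Lemma dot0l (R : realType) (p : nat) (w : 'rV[R]_p) : dot 0 w = 0.
Proof. by rewrite /dot big1// => j _; rewrite mxE mul0r. Qed.

Lemma dot_ge0 (R : realType) (p : nat) (v : 'rV[R]_p) : 0 <= dot v v.
Proof. by apply: sumr_ge0 => j _; rewrite -expr2 sqr_ge0. Qed.

Lemma dot_eq0 (R : realType) (p : nat) (v : 'rV[R]_p) : dot v v = 0 -> v = 0.
Proof.
move/eqP; rewrite psumr_eq0 => [/allP v0|j _]; last by rewrite -expr2 sqr_ge0.
apply/rowP => j; rewrite mxE; apply/eqP.
by have := v0 j (mem_index_enum j); rewrite mulf_eq0 orbb.
Qed.

Lemma enorm_sqr (R : realType) (p : nat) (v : 'rV[R]_p) :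
  enorm v ^+ 2 = dot v v.
Proof. by rewrite sqr_sqrtr// dot_ge0. Qed.

(** * The equations of conformality *)

(** Five positive values of x already determine a quartic, so the coefficients
    can be read off from finitely many evaluations. *)
Lemma quartic_eq0 (R : realType) (c0 c1 c2 c3 c4 : R) :
  (forall x, 0 < x -> c4 * x ^+ 4 + c3 * x ^+ 3 + c2 * x ^+ 2 + c1 * x + c0 = 0) ->
  [/\ c4 = 0, c3 = 0, c2 = 0, c1 = 0 & c0 = 0].
Proof.
move=> H.
have H1 := H 1 ltac:(lra); have H2 := H 2 ltac:(lra); have H3 := H 3 ltac:(lra).
have H4 := H 4 ltac:(lra); have H5 := H 5 ltac:(lra).
by split; lra.
Qed.

(** Weak conformality of [limit_map q a b c d] in terms of its coefficients. *)
Definition conformal_relations (R : realType) (p : nat)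
    (q a b c d : 'rV[R]_p) : Prop :=
  [/\ [/\ dot a a = dot b b, dot a b = 0, dot c c = dot d d & dot c d = 0],
      [/\ dot q a = 0, dot q b = 0, dot q c = 0 & dot q d = 0],
      dot a d = dot b c &
      dot q q = 2 * (dot a c + dot b d)].

(** Here [v1] and [v2] are the two partial derivatives of the limit map at
    s = ln x, theta = 0.  After multiplication by x^2 both equations are quartics
    in x, and their ten coefficients are the relations, with q.a, q.b, q.c and q.d
    each read off from one of the odd powers. *)
Lemma conformal_relationsP (R : realType) (p : nat) (q a b c d : 'rV[R]_p) :
  (forall x : R, 0 < x ->
    let v1 := q + x *: a - x^-1 *: c in let v2 := x *: b + x^-1 *: d in
    dot v1 v1 = dot v2 v2 /\ dot v1 v2 = 0) ->
  conformal_relations q a b c d.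
Proof.
move=> H.
have [E0 E1 E2 E3 E4] : [/\ dot a a - dot b b = 0, 2 * dot q a = 0,
    dot q q - 2 * (dot a c + dot b d) = 0, - (2 * dot q c) = 0
  & dot c c - dot d d = 0].
  apply: quartic_eq0 => x x0; have [+ _] := H x x0; rewrite !dotE => /eqP.
  rewrite -subr_eq0 => /eqP /(congr1 (GRing.mul (x ^+ 2))); rewrite mulr0 => <-.
  rewrite (dotC a q) (dotC c q) (dotC c a) (dotC d b); field; lra.
have [F0 F1 F2 F3 F4] : [/\ dot a b = 0, dot q b = 0,
    dot a d - dot b c = 0, dot q d = 0 & - dot c d = 0].
  apply: quartic_eq0 => x x0; have [_] := H x x0; rewrite !dotE.
  move=> /(congr1 (GRing.mul (x ^+ 2))); rewrite mulr0 => <-.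
  rewrite (dotC c b); field; lra.
by split; [split; lra|split; lra|lra|lra].
Qed.

(** * Four dependent vectors *)

Definition dependent4 (R : realType) (p : nat) (w0 w1 w2 w3 : 'rV[R]_p) : Prop :=
  exists x0 x1 x2 x3 : R, ~ [/\ x0 = 0, x1 = 0, x2 = 0 & x3 = 0] /\
    x0 *: w0 + x1 *: w1 + x2 *: w2 + x3 *: w3 = 0.

(** Four rows whose nonzero entries occupy three columns have a nontrivial
    dependence, which an injective linear map reflects.  In the application [f] is
    the differential of a slice chart, and the vectors that it sends into the
    first three coordinates are the tangent vectors of a 3-manifold. *)
Lemma exists_dependence4 (R : realType) (p : nat) (f : {linear 'rV[R]_p -> 'rV[R]_p})
    (w : 'I_4 -> 'rV[R]_p) : injective f ->
  (forall k (j : 'I_p), (3 <= j)%N -> f (w k) 0 j = 0) ->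
  exists2 x : 'I_4 -> R, (exists k, x k != 0) & \sum_k x k *: w k = 0.
Proof.
move=> finj fw.
(* Only the first three columns of M can be nonzero. *)
pose M : 'M[R]_(4, p) := \matrix_k f (w k).
have : ~~ row_free (M *m (pid_mx 3 : 'M[R]_(p, 3))).
  by rewrite /row_free neq_ltn ltnS rank_leq_col.
rewrite -kermx_eq0 => /rowV0Pn[x /sub_kermxP xM /rV0Pn[k xk]].
exists (x 0); first by exists k.
apply: finj; rewrite linear0 linear_sum; apply/rowP => j.
have fE : \sum_i f (x 0 i *: w i) = x *m M.
  by rewrite mulmx_sum_row; apply: eq_bigr => i _; rewrite linearZ rowK.
rewrite mxE; have [j3|j3] := ltnP j 3; last first.
  by rewrite summxE big1// => i _; rewrite linearZ mxE fw ?mulr0.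
rewrite fE; have /(congr1 (fun A : 'rV[R]_3 => A 0 (Ordinal j3))) := xM.
rewrite mulmxA !mxE (bigD1 j)//= big1 ?addr0.
  by rewrite !mxE/= eqxx j3 mulr1.
by move=> i ij; rewrite !mxE/= (inj_eq val_inj) (negbTE ij) mulr0.
Qed.

Lemma dependent4_tangent (R : realType) (p : nat)
    (T : {linear 'rV[R]_p -> 'rV[R]_p}) (w0 w1 w2 w3 : 'rV[R]_p) :
  injective T ->
  (forall j : 'I_p, (3 <= j)%N ->
    [/\ T w0 0 j = 0, T w1 0 j = 0, T w2 0 j = 0 & T w3 0 j = 0]) ->
  dependent4 w0 w1 w2 w3.
Proof.
move=> Tinj Tw; pose w (k : 'I_4) := [:: w0; w1; w2; w3]`_k.
have [|x [k xk]] := @exists_dependence4 R p T w Tinj.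
  by move=> [[|[|[|[|//]]]] k4] j /Tw [T0 T1 T2 T3].
rewrite !big_ord_recl big_ord0 addr0 /w /= !addrA => xw.
do 4 eexists; split; last exact: xw.
case: k xk => [[|[|[|[|//]]]] k4] /eqP xk [x0 x1 x2 x3]; apply: xk.
- by rewrite -x0; congr x; exact: val_inj.
- by rewrite -x1; congr x; exact: val_inj.
- by rewrite -x2; congr x; exact: val_inj.
- by rewrite -x3; congr x; exact: val_inj.
Qed.

(** Pairing a dependence with each of its vectors is how it meets the
    conformality relations. *)
Lemma dependent4_dot (R : realType) (p : nat) (w0 w1 w2 w3 : 'rV[R]_p) x0 x1 x2 x3 v :
  x0 *: w0 + x1 *: w1 + x2 *: w2 + x3 *: w3 = 0 ->
  x0 * dot v w0 + x1 * dot v w1 + x2 * dot v w2 + x3 * dot v w3 = 0.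
Proof. by move=> /(congr1 (dot v)); rewrite !dotE => ->; rewrite dotC dot0l. Qed.

(** The squared length of the difference of the two sides is [dot a a] times
    the defect in Bessel's inequality. *)
Lemma bessel_equality (R : realType) (p : nat) (a b v : 'rV[R]_p) :
  dot a b = 0 -> dot a a = dot b b ->
  dot a a * dot v v = dot a v ^+ 2 + dot b v ^+ 2 ->
  dot a a *: v = dot a v *: a + dot b v *: b.
Proof.
move=> ab aabb E; apply/eqP; rewrite -subr_eq0; apply/eqP; apply: dot_eq0.
rewrite !dotE -!aabb !(dotC v) (dotC b a) ab.
set A := dot a a in E *; set X := dot a v in E *; set Y := dot b v in E *.
transitivity (A * (A * dot v v - (X ^+ 2 + Y ^+ 2))); first by ring.
by rewrite E subrr mulr0.
Qed.

(** Write A = a.a, C = c.c, X = a.c, Y = a.d.  The Gram matrix of a, b, c, d has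
    diagonal blocks A and C times the identity, and its off-diagonal block
    has rows (X, Y) and (Y, -X), which is sqrt (X^2 + Y^2) times an orthogonal
    matrix.  It is therefore singular only if A C = X^2 + Y^2. *)
Lemma bessel_eq_of_dependent (R : realType) (p : nat) (a b c d : 'rV[R]_p) :
  a != 0 -> conformal_relations 0 a b c d -> dependent4 a b c d ->
  dot a a * dot c c = dot a c ^+ 2 + dot a d ^+ 2.
Proof.
move=> a0 [[aabb ab ccdd cd] _ adbc]; rewrite dot0l.
move=> tr [x0 [x1 [x2 [x3 [nz E]]]]].
have Ea := dependent4_dot a E; have Eb := dependent4_dot b E.
have Ec := dependent4_dot c E; have Ed := dependent4_dot d E.
have aa0 : dot a a != 0 by apply: contra_neq a0; exact: dot_eq0.
rewrite ab in Ea; rewrite (dotC b a) ab -aabb -adbc in Eb.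
rewrite (dotC c a) (dotC c b) -adbc cd in Ec.
rewrite (dotC d a) (dotC d b) (dotC d c) cd -ccdd in Ed.
have bd : dot b d = - dot a c by lra.
rewrite bd in Eb Ed; move: (dot a a) (dot a c) (dot a d) (dot c c) aa0 Ea Eb Ec Ed
  {aabb ab ccdd cd adbc tr E bd} => A X Y C A0 Ea Eb Ec Ed.
(* Eliminate x0 and x1 from the four paired equations. *)
have F2 : x2 * (A * C - (X ^+ 2 + Y ^+ 2)) = 0.
  have -> : x2 * (A * C - (X ^+ 2 + Y ^+ 2)) =
    A * (x0 * X + x1 * Y + x2 * C + x3 * 0)
    - X * (x0 * A + x1 * 0 + x2 * X + x3 * Y)
    - Y * (x0 * 0 + x1 * A + x2 * Y + x3 * - X) by ring.
  by rewrite Ea Eb Ec; ring.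
have F3 : x3 * (A * C - (X ^+ 2 + Y ^+ 2)) = 0.
  have -> : x3 * (A * C - (X ^+ 2 + Y ^+ 2)) =
    A * (x0 * Y + x1 * - X + x2 * 0 + x3 * C)
    - Y * (x0 * A + x1 * 0 + x2 * X + x3 * Y)
    + X * (x0 * 0 + x1 * A + x2 * Y + x3 * - X) by ring.
  by rewrite Ea Eb Ed; ring.
apply/eqP; rewrite -subr_eq0; apply: contra_notT nz => nz.
have x20 : x2 = 0 by apply: (mulIf nz); rewrite F2 mul0r.
have x30 : x3 = 0 by apply: (mulIf nz); rewrite F3 mul0r.
by rewrite x20 x30 in Ea Eb *; split=> //; apply: (mulIf A0); lra.
Qed.

(** Since [q] is orthogonal to the three other vectors, it drops out of the
    dependence; what is left expresses [v] by the orthogonal pair (a, b), so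
    Bessel's inequality is an equality for [v]. *)
Lemma bessel_eq_of_orthogonal (R : realType) (p : nat) (q a b v : 'rV[R]_p) :
  q != 0 -> a != 0 -> dot a a = dot b b -> dot a b = 0 ->
  dot q a = 0 -> dot q b = 0 -> dot q v = 0 -> dependent4 q a b v ->
  dot a a * dot v v = dot a v ^+ 2 + dot b v ^+ 2.
Proof.
move=> q0 a0 aabb ab qa qb qv [x0 [x1 [x2 [x3 [nz E]]]]].
have Eq := dependent4_dot q E; have Ea := dependent4_dot a E.
have Eb := dependent4_dot b E; have Ev := dependent4_dot v E.
have qq0 : dot q q != 0 by apply: contra_neq q0; exact: dot_eq0.
have aa0 : dot a a != 0 by apply: contra_neq a0; exact: dot_eq0.
rewrite qa qb qv in Eq; rewrite (dotC a q) qa ab in Ea.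
rewrite (dotC b q) qb (dotC b a) ab -aabb in Eb.
rewrite (dotC v q) qv (dotC v a) (dotC v b) in Ev.
have x00 : x0 = 0 by apply: (mulIf qq0); lra.
move: (dot a a) (dot a v) (dot b v) (dot v v) aa0 Ea Eb Ev {Eq E aabb} =>
  A X Y C A0 Ea Eb Ev.
have [x30|x30] := eqVneq x3 0.
  case: nz; split=> //; apply: (mulIf A0); rewrite x30 in Ea Eb; lra.
apply: (mulfI x30); apply/eqP; rewrite -subr_eq0.
have -> : x3 * (A * C) - x3 * (X ^+ 2 + Y ^+ 2) =
    A * (x0 * 0 + x1 * X + x2 * Y + x3 * C)
    - X * (x0 * 0 + x1 * A + x2 * 0 + x3 * X)
    - Y * (x0 * 0 + x1 * 0 + x2 * A + x3 * Y) by ring.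
by rewrite Ea Eb Ev; apply/eqP; ring.
Qed.

(** * The planes of (a, b) and (c, d) *)

Lemma conformal_pair_free (R : realType) (p : nat) (a b : 'rV[R]_p) :
  dot a a != 0 -> dot a a = dot b b -> dot a b = 0 -> free [:: a; b].
Proof.
move=> a0 aabb ab; rewrite free_cons seq1_free span_seq1.
apply/andP; split; last first.
  by apply: contra_neq a0 => b0; rewrite aabb b0 dot0l.
apply/negP => /vlineP[k ak]; move/eqP: a0; apply.
by rewrite {1}ak dotZl dotC ab mulr0.
Qed.

(** One inclusion suffices, since both planes have dimension 2. *)
Lemma eq_span_free2 (R : realType) (p : nat) (a b c d : 'rV[R]_p)
    (x y z w : R) :
  free [:: a; b] -> free [:: c; d] ->
  c = x *: a + y *: b -> d = z *: a + w *: b ->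
  <<[:: a; b]>>%VS = <<[:: c; d]>>%VS.
Proof.
move=> fab fcd cE dE; apply/esym/eqP; rewrite eqEdim.
rewrite (eqP fab) (eqP fcd) leqnn andbT; apply/span_subvP => v.
have ain : a \in <<[:: a; b]>>%VS by rewrite memv_span ?inE ?eqxx.
have bin : b \in <<[:: a; b]>>%VS by rewrite memv_span ?inE ?eqxx ?orbT.
by rewrite !inE => /orP[] /eqP ->; rewrite ?cE ?dE; apply: memvD; apply: memvZ.
Qed.

Lemma det_mx22 (R : comPzRingType) (A : 'M[R]_2) :
  \det A = A ord0 ord0 * A ord_max ord_max - A ord0 ord_max * A ord_max ord0.
Proof.
have lift0E (i : 'I_1) : lift ord0 i = ord_max :> 'I_2.
  by apply: val_inj; rewrite /= [i]ord1.
have liftmE (i : 'I_1) : lift ord_max i = ord0 :> 'I_2.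
  by apply: val_inj; rewrite /= [i]ord1.
rewrite (expand_det_row _ ord0) !big_ord_recl big_ord0 /cofactor !det_mx11 !mxE.
rewrite !lift0E !liftmE /=; ring.
Qed.

Lemma opposite_orientation_coefs (R : realType) (p : nat) (a b c d : 'rV[R]_p)
    (x y z w : R) :
  c = x *: a + y *: b -> d = z *: a + w *: b -> x * w - y * z < 0 ->
  opposite_orientation a b c d.
Proof.
move=> -> -> xwyz.
pose M : 'M[R]_(1 + 1) := block_mx x%:M y%:M z%:M w%:M.
have ME : M *m col_mx a b = col_mx (x *: a + y *: b) (z *: a + w *: b).
  by rewrite mul_block_col !mul_scalar_mx.
exists M; split; first exact: esym ME.
have -> : \det M = x * w - y * z; last by [].
have lE : ord0 = lshift 1 0 :> 'I_(1 + 1) by exact: val_inj.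
have rE : ord_max = rshift 1 0 :> 'I_(1 + 1) by exact: val_inj.
have M00 : M ord0 ord0 = x by rewrite lE block_mxEul mxE mulr1n.
have M01 : M ord0 ord_max = y by rewrite lE rE block_mxEur mxE mulr1n.
have M10 : M ord_max ord0 = z by rewrite lE rE block_mxEdl mxE mulr1n.
have M11 : M ord_max ord_max = w by rewrite rE block_mxEdr mxE mulr1n.
by rewrite det_mx22 M00 M01 M10 M11.
Qed.

(** For q = 0 the trace relation gives b.d = -a.c, so c and d have the same
    Bessel defect with respect to (a, b). *)
Lemma planes_q_eq0 (R : realType) (p : nat) (a b c d : 'rV[R]_p) :
  a != 0 -> conformal_relations 0 a b c d -> dependent4 a b c d ->
  [/\ c = (dot a c / dot a a) *: a + (dot a d / dot a a) *: b,
      d = (dot a d / dot a a) *: a + (- dot a c / dot a a) *: b &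
      dot a a * dot c c = dot a c ^+ 2 + dot a d ^+ 2].
Proof.
move=> a0 rel dep; have G := bessel_eq_of_dependent a0 rel dep.
have aa0 : dot a a != 0 by apply: contra_neq a0; exact: dot_eq0.
have [[aabb ab ccdd cd] _ adbc tr] := rel; rewrite dot0l in tr.
have bd : dot b d = - dot a c by lra.
have Ec : dot a a *: c = _ := bessel_equality ab aabb _.
have Ed : dot a a *: d = _ := bessel_equality ab aabb _.
split=> //; apply: (scalerI aa0).
- rewrite Ec ?adbc// -adbc// scalerDr !scalerA ![_ * (_ / _)]mulrC !divfK//.
- rewrite Ed; last by rewrite bd sqrrN -ccdd G addrC.
  by rewrite bd scalerDr !scalerA ![_ * (_ / _)]mulrC !divfK.
Qed.

(** Write X = a.c, Y = a.d = b.c, Z = b.d.  Then A c = X a + Y b and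
    A d = Y a + Z b, where X + Z > 0 is half of |q|^2.  Orthogonality of c and d
    reads Y (X + Z) = 0, and equality of their lengths X^2 = Z^2, so Y = 0 and
    X = Z. *)
Lemma planes_q_neq0 (R : realType) (p : nat) (q a b c d : 'rV[R]_p) :
  q != 0 -> a != 0 -> conformal_relations q a b c d ->
  dependent4 q a b c -> dependent4 q a b d ->
  exists2 l : R, 0 < l & a = l *: c /\ b = l *: d.
Proof.
move=> q0 a0 [[aabb ab ccdd cd] [qa qb qc qd] adbc qq] depc depd.
have Gc := bessel_eq_of_orthogonal q0 a0 aabb ab qa qb qc depc.
have Gd := bessel_eq_of_orthogonal q0 a0 aabb ab qa qb qd depd.
have Ec := bessel_equality ab aabb Gc.
have Ed := bessel_equality ab aabb Gd.
have aa0 : 0 < dot a a.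
  by rewrite lt_neqAle dot_ge0 andbT eq_sym; apply: contra_neq a0; exact: dot_eq0.
have qq0 : 0 < dot q q.
  by rewrite lt_neqAle dot_ge0 andbT eq_sym; apply: contra_neq q0; exact: dot_eq0.
have Y0 : dot a d = 0.
  have := congr1 (fun v => dot v (dot a a *: d)) Ec.
  rewrite !dotE cd -adbc => E.
  have : dot a d * (dot a c + dot b d) = 0.
    by apply: (mulfI (lt0r_neq0 aa0)); lra.
  by move=> /eqP; rewrite mulf_eq0 => /orP[/eqP//|/eqP]; lra.
rewrite -adbc Y0 in Ec Ed Gc Gd.
have XZ : dot a c = dot b d.
  have : (dot a c - dot b d) * (dot a c + dot b d) = 0.
    by rewrite -ccdd in Gd; lra.
  by move=> /eqP; rewrite mulf_eq0 => /orP[/eqP|/eqP]; lra.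
have X0 : 0 < dot a c by lra.
exists (dot a a / dot a c); first exact: divr_gt0.
rewrite scale0r add0r -XZ in Ed; rewrite scale0r addr0 in Ec.
split; apply: (scalerI (lt0r_neq0 X0)); rewrite scalerA mulrC divfK ?lt0r_neq0//.
Qed.

(** * The catenoid *)

(** The shift s + k with k = (ln l) / 2 balances the two exponentials:
    l e^s + e^-s = 2 r cosh (s + k), where r = e^k is the square root of l.  The map
    [F] sends the standard frame to 2 r c, 2 r d, q, which are orthogonal of the same
    length |q|, because |q|^2 = 4 l |c|^2. *)
Lemma catenoid_limit_map (R : realType) (p : nat) (q c d : 'rV[R]_p) (l : R) :
  0 < l -> q != 0 -> conformal_relations q (l *: c) (l *: d) c d ->
  catenoid_up_to_similarity (range (limit_map q (l *: c) (l *: d) c d)).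
Proof.
move=> l0 q0 [[_ _ ccdd cd] [_ _ qc qd] _ qq].
pose k := 2^-1 * ln l; pose r := expR k.
have r0 : 0 < r by exact: expR_gt0.
have rr : r * r = l by rewrite -expRD (_ : k + k = ln l) ?lnK// /k; field.
have rV : expR (- k) = r^-1 by rewrite expRN.
have qqE : dot q q = 4 * l * dot c c by rewrite qq !dotZl -ccdd; ring.
pose i0 : 'I_3 := ord0; pose i1 : 'I_3 := lift ord0 ord0.
pose i2 : 'I_3 := lift ord0 (lift ord0 ord0).
pose F (y : 'rV[R]_3) : 'rV[R]_p :=
  (y 0 i2 - k) *: q + (2 * r * y 0 i0) *: c + (2 * r * y 0 i1) *: d.
have FE z : limit_map q (l *: c) (l *: d) c d z =
    F (\row_(j < 3) [:: (expR (z.1 + k) + expR (- (z.1 + k))) / 2 * cos z.2;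
      (expR (z.1 + k) + expR (- (z.1 + k))) / 2 * sin z.2; z.1 + k]`_j).
  rewrite /F /limit_map !mxE /= opprD !expRD rV -/r addrK -rr.
  apply/rowP => j; rewrite !mxE; field; lra.
exists F.
  exists (enorm q).
    rewrite /enorm sqrtr_gt0 lt_neqAle dot_ge0 andbT eq_sym.
    by apply: contra_neq q0; exact: dot_eq0.
  move=> x y; rewrite /enorm -sqrtrM ?dot_ge0//; congr Num.sqrt.
  have -> : F x - F y = (x 0 i2 - y 0 i2) *: q
      + (2 * r * (x 0 i0 - y 0 i0)) *: c + (2 * r * (x 0 i1 - y 0 i1)) *: d.
    by apply/rowP => j; rewrite !mxE; ring.
  have -> : dot (x - y) (x - y) = (x 0 i0 - y 0 i0) ^+ 2
      + (x 0 i1 - y 0 i1) ^+ 2 + (x 0 i2 - y 0 i2) ^+ 2.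
    by rewrite /dot !big_ord_recl big_ord0 !mxE; ring.
  rewrite !dotE (dotC c q) (dotC d q) (dotC d c) qc qd cd -ccdd qqE -rr; ring.
apply/seteqP; split=> [_ [z _ <-]|_ [_ [z _ <-] <-]].
  by rewrite FE; eexists; [exists (z.1 + k, z.2)|].
by exists (z.1 - k, z.2) => //; rewrite FE /= subrK.
Qed.

(** * Calculus of differentials *)

Lemma is_diff_fst (R : realType) (z : R * R) : is_diff z fst fst.
Proof.
have c : continuous (fst : {linear (R * R)%type -> R}) by move=> x; exact: cvg_fst.
by apply: DiffDef; [exact: linear_differentiable c|rewrite diff_lin].
Qed.

Lemma is_diff_snd (R : realType) (z : R * R) : is_diff z snd snd.
Proof.
have c : continuous (snd : {linear (R * R)%type -> R}) by move=> x; exact: cvg_snd.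
by apply: DiffDef; [exact: linear_differentiable c|rewrite diff_lin].
Qed.

Lemma is_diff_derive1 (R : realType) (f : R -> R) (x df : R) :
  is_derive x 1 f df -> is_diff x f ( *%R^~ df).
Proof.
move=> fdf; have dfx : differentiable f x by apply/derivable1_diffP.
by apply: DiffDef => //; rewrite diff1E// derive1E derive_val.
Qed.

Lemma is_diffZl (R : realType) (V W : normedModType R) (k dk : V -> R) (w : W)
    (z : V) :
  is_diff z k dk -> is_diff z (fun y => k y *: w) (fun y => dk y *: w).
Proof.
move=> kdk; apply: DiffDef; first exact: differentiableZl.
by rewrite diffZl// diff_val.
Qed.

Lemma is_diff_deriveE (R : realType) (V W : normedModType R) (f df : V -> W)
    (z v : V) : is_diff z f df -> 'D_v f z = df v.
Proof. by move=> D; rewrite deriveE// diff_val. Qed.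

(** The differential of a left inverse is a left inverse of the
    differential. *)
Lemma diff_left_inverse_inj (R : realType) (V : normedModType R)
    (Phi dPhi Psi : V -> V) (x : V) :
  is_diff x Phi dPhi -> differentiable Psi (Phi x) ->
  (\forall y \near x, Psi (Phi y) = y) -> injective dPhi.
Proof.
move=> DPhi /differentiableP DPsi PsiPhi; have D := is_diff_comp DPhi DPsi.
apply: (can_inj (g := 'd Psi (Phi x))) => v.
rewrite -[LHS]/(('d Psi (Phi x) \o dPhi) v) -(is_diff_deriveE v D).
by rewrite (near_eq_derive v (g := id) PsiPhi) derive_id.
Qed.

(** A map into a submanifold that [Phi] straightens has its derivative in the
    kernel of the transverse components of the differential of [Phi]. *)
Lemma diff_flat_coord (R : realType) (V : normedModType R) (p : nat)
    (g dg : V -> 'rV[R]_p) (Phi dPhi : 'rV[R]_p -> 'rV[R]_p) (j : 'I_p)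
    (z v : V) :
  is_diff z g dg -> is_diff (g z) Phi dPhi ->
  (\forall y \near z, Phi (g y) 0 j = 0) -> dPhi (dg v) 0 j = 0.
Proof.
move=> Dg DPhi g0; have D := is_diff_comp Dg DPhi.
rewrite -[dPhi _]/((dPhi \o dg) v) -(is_diff_deriveE v D).
have DPg : derivable (Phi \o g) z v.
  by apply: diff_derivable; exact: ex_diff.
rewrite (derive_mx DPg) mxE.
by rewrite (near_eq_derive v (g := cst 0) g0) derive_cst.
Qed.

(** This turns the differential into partial derivatives at a variable point,
    to which smoothness applies. *)
Lemma diff_rV_sum (R : realType) (p : nat) (W : normedModType R)
    (f : 'rV[R]_p -> W) (y w : 'rV[R]_p) : differentiable f y ->
  'd f y w = \sum_k w 0 k *: 'D_(delta_mx 0 k) f y.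
Proof.
move=> df; rewrite {1}[w]row_sum_delta linear_sum; apply: eq_bigr => k _.
by rewrite linearZ (deriveE _ df).
Qed.

Lemma cvg_sum_fun (R : realType) (V : normedModType R) (T I : Type)
    (F : set_system T) {FF : Filter F} (r : seq I) (f : I -> T -> V) (l : I -> V) :
  (forall k, f k @ F --> l k) ->
  (fun t => \sum_(k <- r) f k t) @ F --> \sum_(k <- r) l k.
Proof.
move=> fl; rewrite -fct_sumE; elim/big_ind2 : _ => //.
- exact: cvg_cst.
- by move=> f1 l1 f2 l2; exact: cvgD.
Qed.

(** Joint continuity of the differential in the point and the vector: the
    partial derivatives of a smooth map are continuous. *)
Lemma cvg_diff (R : realType) (p : nat) (W : normedModType R)
    (f : 'rV[R]_p -> W) (U : set 'rV[R]_p) (T : Type)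
    (F : set_system T) {FF : Filter F} (y w : T -> 'rV[R]_p) (y0 w0 : 'rV[R]_p) :
  smooth_on U f -> open U -> U y0 ->
  y @ F --> y0 -> w @ F --> w0 ->
  (fun t => 'd f (y t) (w t)) @ F --> 'd f y0 w0.
Proof.
move=> smf Uo Uy0 yy0 ww0.
have df x : U x -> differentiable f x := smf [::] x.
have E : \forall t \near F,
    \sum_k w t 0 k *: 'D_(delta_mx 0 k) f (y t) = 'd f (y t) (w t).
  have nU : nbhs y0 U by exact: open_nbhs_nbhs.
  have FU : \forall t \near F, U (y t) := yy0 U nU.
  apply: filterS FU => t Uyt.
  exact: esym (diff_rV_sum (w t) (df _ Uyt)).
apply: cvg_trans (near_eq_cvg E) _.
apply: (eq_ind_r (fun l => _ @ F --> l) _ (diff_rV_sum w0 (df y0 Uy0))).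
apply: cvg_sum_fun => k; apply: cvgZ.
  have coordk := @coord_continuous R 1 p 0 k w0.
  exact: (cvg_comp w _ ww0 coordk).
have partialk : {for y0, continuous ('D_(delta_mx 0 k) f)}.
  exact/differentiable_continuous/(smf [:: delta_mx 0 k] y0 Uy0).
exact: (cvg_comp y _ yy0 partialk).
Qed.

Lemma cvg_dot (R : realType) (p : nat) (T : Type) (F : set_system T) {FF : Filter F}
    (v w : T -> 'rV[R]_p) (v0 w0 : 'rV[R]_p) :
  v @ F --> v0 -> w @ F --> w0 ->
  (fun t => dot (v t) (w t)) @ F --> dot v0 w0.
Proof.
move=> vv0 ww0; apply: cvg_sum_fun => j.
have coordv := @coord_continuous R 1 p 0 j v0.
have coordw := @coord_continuous R 1 p 0 j w0.
exact: cvgM (cvg_comp v _ vv0 coordv) (cvg_comp w _ ww0 coordw).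
Qed.

(** Points are compact, so smooth convergence gives pointwise convergence of
    all derivatives. *)
Lemma cvg_smooth_at (R : realType) (V W : normedModType R)
    (f : nat -> V -> W) (g : V -> W) (s : seq V) (z : V) :
  cvg_smooth setT setT f g ->
  (fun i => iter_derive s (f i) z) @ \oo --> iter_derive s g z.
Proof.
move=> [_ /(_ s [set z])]; rewrite setIT uniform_set1; apply=> //.
exact: compact_set1.
Qed.

Lemma cvg_subsequence (phi : nat -> nat) : subsequence phi -> phi @ \oo --> \oo.
Proof.
move=> phiS; have phi_ge i : (i <= phi i)%N.
  by elim: i => // i IH; apply: leq_ltn_trans IH (phiS _ _ _).
by move=> A [m _ mA]; exists m => // i mi; apply: mA; exact: leq_trans mi _.
Qed.

(** An ultrafilter on the indices plays the role of a convergent subsequence: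
    its image in a compact set converges. *)
Lemma ultra_fmap (T T' : Type) (f : T -> T') (F : set_system T) :
  UltraFilter F -> UltraFilter (f @ F).
Proof.
move=> FU; split=> [|G GF sFG]; first exact: fmap_proper_filter.
rewrite eqEsubset; split=> // A GA.
have [//|FA] := in_ultra_setVsetC (f @^-1` A) FU.
have GAc : G (~` A) by apply: sFG; exact: FA.
have G0 : G set0 by rewrite -(setICr A); exact: filterI.
by case: (@filter_not_empty _ G _ G0).
Qed.

(** * Neck maps in cylinder coordinates *)

Lemma is_diff_cyl (R : realType) (z : R * R) :
  is_diff z (@cyl R) (fun v =>
    (expR z.1 * (v.1 * cos z.2 - v.2 * sin z.2),
     expR z.1 * (v.1 * sin z.2 + v.2 * cos z.2))).
Proof.
have dexp := is_diff_comp (is_diff_fst z) (is_diff_derive1 (is_derive_expR z.1)).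
have dcos := is_diff_comp (is_diff_snd z) (is_diff_derive1 (is_derive_cos z.2)).
have dsin := is_diff_comp (is_diff_snd z) (is_diff_derive1 (is_derive_sin z.2)).
apply: (is_diff_eq (is_diff_pair (is_diffM dexp dcos) (is_diffM dexp dsin))).
apply/funext => v; rewrite /=; congr pair; rewrite !fctE /= /GRing.scale/=; ring.
Qed.

(** The differential is computed along the ray theta = 0; its two components
    are the vectors of [conformal_relationsP] for x = e^s. *)
Lemma is_diff_limit_map (R : realType) (p : nat) (q a b c d : 'rV[R]_p)
    (s : R) :
  is_diff (s, 0) (limit_map q a b c d) (fun v =>
    v.1 *: (q + expR s *: a - (expR s)^-1 *: c)
    + v.2 *: (expR s *: b + (expR s)^-1 *: d)).
Proof.
have D (z : R * R) := is_diff_cyl z.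
have Da := is_diff_comp (D (s, 0)) (is_diff_fst _).
have Db := is_diff_comp (D (s, 0)) (is_diff_snd _).
(* The coefficients of c and d are the polar coordinates at (- s, theta). *)
pose refl (z : R * R) := (- z.1, z.2).
have Drefl : is_diff ((s, 0) : R * R) refl refl.
  by apply: is_diff_pair; [apply: is_diffN; exact: is_diff_fst|exact: is_diff_snd].
have Dc := is_diff_comp (is_diff_comp Drefl (D _)) (is_diff_fst _).
have Dd := is_diff_comp (is_diff_comp Drefl (D _)) (is_diff_snd _).
have := is_diffD (is_diffD (is_diffD (is_diffD (is_diffZl q (is_diff_fst _))
  (is_diffZl a Da)) (is_diffZl b Db)) (is_diffZl c Dc)) (is_diffZl d Dd).
move/is_diff_eq; apply; apply/funext => v; rewrite !fctE /= sin0 cos0 expRN.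
by apply/rowP => j; rewrite !mxE; ring.
Qed.

(** The rescaled map before the affine normalization of its values, which would
    move them out of N. *)
Definition neck_map (R : realType) (p : nat) (u : R * R -> 'rV[R]_p) (k : R)
  (z : R * R) : 'rV[R]_p := u (cyl (z.1 + k, z.2)).

(** On the ray theta = 0 the differential of polar coordinates is multiplication
    by the radius: this is where conformality of polar coordinates enters. *)
Lemma is_diff_neck_map (R : realType) (p : nat) (u : R * R -> 'rV[R]_p)
    (k s : R) : differentiable u (expR (s + k), 0) ->
  is_diff (s, 0) (neck_map u k) (fun v =>
    'd u (expR (s + k), 0) (expR (s + k) *: v)).
Proof.
move=> du.
have Dshift : is_diff ((s, 0) : R * R) (fun z => (z.1 + k, z.2)) id.
  apply: (is_diff_eq (is_diff_pair (is_diffD (is_diff_fst _) (is_diff_cst k _))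
    (is_diff_snd _))).
  by apply/funext => -[x y]; rewrite fctE /= addr0.
have D := is_diff_comp Dshift (is_diff_cyl _).
have cylE : cyl (s + k, 0) = (expR (s + k), 0) :> R * R.
  by rewrite /cyl/= cos0 sin0 mulr1 mulr0.
have du' : is_diff (cyl (s + k, 0)) u ('d u (expR (s + k), 0)).
  by rewrite cylE; exact/differentiableP.
apply: (is_diff_eq (is_diff_comp D du')).
apply/funext => -[x y] /=; rewrite cos0 sin0 !mulr1 !mulr0 subr0 add0r.
by [].
Qed.

Lemma is_diff_rescaled (R : realType) (p : nat) (u : R * R -> 'rV[R]_p)
    (lam : R) (P Q : 'rV[R]_p) (z : R * R) (dw : R * R -> 'rV[R]_p) :
  is_diff z (neck_map u (2^-1 * ln lam)) dw ->
  is_diff z (rescaled u lam P Q) (fun v => (Num.sqrt lam)^-1 *: dw v).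
Proof.
move=> D; have := is_diffZ (Num.sqrt lam)^-1
  (is_diffB D (is_diff_cst (P + (2^-1 * ln lam) *: Q) z)).
by move/is_diff_eq; apply; apply/funext => v; rewrite !fctE subr0.
Qed.

Lemma enorm2_cyl (R : realType) (z : R * R) : enorm2 (cyl z) = expR z.1.
Proof.
rewrite /enorm2 /= !exprMn -mulrDr cos2Dsin2 mulr1 sqrtr_sqr.
by rewrite gtr0_norm// expR_gt0.
Qed.

Lemma ray_in_disk (R : realType) (s : R) : s < 0 -> disk 1 (expR s, 0).
Proof.
move=> s0; have := enorm2_cyl (s, 0); rewrite /cyl /= cos0 sin0 mulr1 mulr0.
by rewrite /disk /= => ->; rewrite -expR0 ltr_expR.
Qed.

Lemma near_neck_disk (R : realType) (k : R) (z : R * R) : z.1 + k < 0 ->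
  \forall y \near z, disk 1 (cyl (y.1 + k, y.2)).
Proof.
move=> zk; have : \forall y \near z, y.1 < - k.
  have fst_cont : {for z, continuous fst}.
    by have ? := is_diff_fst z; exact: differentiable_continuous.
  by apply: (fst_cont [set x | x < - k]); apply: lt_nbhsl; lra.
apply: filterS => y yk; rewrite /disk /= enorm2_cyl /=.
by rewrite -expR0 ltr_expR; lra.
Qed.

(** For fixed s the rescaled map is evaluated at radius e^s sqrt(mu i), which
    tends to 0 and so ends up inside the unit disk. *)
Lemma near_neck_ray (R : realType) (mu : nat -> R) (s : R) :
  (forall i, 0 < mu i) -> mu @ \oo --> (0 : R) ->
  \forall i \near \oo, s + 2^-1 * ln (mu i) < 0.
Proof.
move=> mu0 cmu.
have E : \forall i \near \oo, mu i < expR (- (2 * s)).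
  by apply: (cmu [set x | x < _]); apply: lt_nbhsl; exact: expR_gt0.
apply: filterS E => i; rewrite -ltr_ln ?posrE ?expR_gt0// expRK => ?; lra.
Qed.

(** * Conformality of the limit map *)

(** By [is_diff_neck_map], both partial derivatives of the rescaled map are the
    same multiple of those of [u]. *)
Lemma conformal_rescaled (R : realType) (p : nat) (u : R * R -> 'rV[R]_p)
    (lam : R) (P Q : 'rV[R]_p) (s : R) :
  smooth_on (disk 1) u -> weakly_conformal (disk 1) u ->
  s + 2^-1 * ln lam < 0 ->
  let w := rescaled u lam P Q in
  dot (D1 w (s, 0)) (D1 w (s, 0)) = dot (D2 w (s, 0)) (D2 w (s, 0)) /\
  dot (D1 w (s, 0)) (D2 w (s, 0)) = 0.
Proof.
move=> smu cu sk w; have inD := ray_in_disk sk.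
have du : differentiable u (expR (s + 2^-1 * ln lam), 0) := smu [::] _ inD.
have Dw := is_diff_rescaled P Q (is_diff_neck_map du).
have [A1 A2] : enorm (D1 u (expR (s + 2^-1 * ln lam), 0)) =
    enorm (D2 u (expR (s + 2^-1 * ln lam), 0)) /\ _ := cu _ inD.
have DwE v : 'D_v w (s, 0) = (Num.sqrt lam)^-1 *: (expR (s + 2^-1 * ln lam) *:
    'D_v u (expR (s + 2^-1 * ln lam), 0)).
  rewrite (is_diff_deriveE v Dw) linearZ; congr (_ *: (_ *: _)).
  exact: esym (deriveE v du).
(* Both derivatives carry the same factor, which cancels. *)
have W1 : D1 w (s, 0) = _ := DwE (1, 0); have W2 : D2 w (s, 0) = _ := DwE (0, 1).
move: W1 W2 A1 A2; rewrite -!/(D1 _ _) -!/(D2 _ _).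
move: (D1 u _) (D2 u _) => A B -> -> /(congr1 (fun x => x ^+ 2)).
by rewrite !enorm_sqr !dotZl !dotZr => -> ->; rewrite !mulr0.
Qed.

Lemma conformal_limit (R : realType) (p : nat) (u : nat -> R * R -> 'rV[R]_p)
    (mu : nat -> R) (P Q : nat -> 'rV[R]_p) (q a b c d : 'rV[R]_p) :
  (forall i, smooth_on (disk 1) (u i)) ->
  (forall i, weakly_conformal (disk 1) (u i)) ->
  (forall i, 0 < mu i) -> mu @ \oo --> (0 : R) ->
  cvg_smooth setT setT (fun i => rescaled (u i) (mu i) (P i) (Q i))
    (limit_map q a b c d) ->
  conformal_relations q a b c d.
Proof.
move=> smu cu mu0 cmu cw; apply: conformal_relationsP => x x0 /=.
have c1 := cvg_smooth_at (s := [:: ((1, 0) : R * R)]) (z := (ln x, 0)) cw.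
have c2 := cvg_smooth_at (s := [:: ((0, 1) : R * R)]) (z := (ln x, 0)) cw.
have ev := near_neck_ray (ln x) mu0 cmu.
have Dl := is_diff_limit_map q a b c d (ln x).
rewrite /= !(is_diff_deriveE _ Dl) /= !lnK ?posrE// in c1 c2.
rewrite !scale1r !scale0r ?addr0 ?add0r in c1 c2.
split.
- have L1 := cvg_dot (FF := eventually_filter) c1 c1.
  have L2 := cvg_dot (FF := eventually_filter) c2 c2.
  apply: (cvg_unique (@Rhausdorff R) L1).
  apply: cvg_trans L2; apply: near_eq_cvg.
  apply: filterS ev => i sk.
  have [E _] := conformal_rescaled (P i) (Q i) (smu i) (cu i) sk.
  by move: E; rewrite /D1 /D2 => ->.
- have L1 := cvg_dot (FF := eventually_filter) c1 c2.
  apply: (cvg_unique (@Rhausdorff R) L1).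
  apply: cvg_trans (@cvg_cst R 0 nat \oo _); apply: near_eq_cvg.
  apply: filterS ev => i sk.
  have [_ E] := conformal_rescaled (P i) (Q i) (smu i) (cu i) sk.
  by move: E; rewrite /D1 /D2 => ->.
Qed.

(** * Tangency of the limit map *)

(** The constants [P] and [Q] cancel in differences, which leaves only the
    factor sqrt(lam). *)
Lemma neck_mapE (R : realType) (p : nat) (u : R * R -> 'rV[R]_p) (lam : R)
    (P Q : 'rV[R]_p) (z : R * R) : 0 < lam ->
  neck_map u (2^-1 * ln lam) z =
  neck_map u (2^-1 * ln lam) 0
  + Num.sqrt lam *: (rescaled u lam P Q z - rescaled u lam P Q 0).
Proof.
move=> l0; rewrite /rescaled -scalerBr opprB addrA subrK scalerA.
rewrite divff ?scale1r ?gt_eqF ?sqrtr_gt0//.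
by rewrite [RHS]addrC subrK.
Qed.

(** Distances between points of a neck are of order sqrt(mu i), so one
    convergent point drags all others along. *)
Lemma cvg_neck_map (R : realType) (p : nat) (u : nat -> R * R -> 'rV[R]_p)
    (mu : nat -> R) (P Q : nat -> 'rV[R]_p) (g : R * R -> 'rV[R]_p)
    (F : set_system nat) {FF : Filter F} (n : 'rV[R]_p) (z : R * R) :
  (forall i, 0 < mu i) -> mu @ \oo --> (0 : R) ->
  cvg_smooth setT setT (fun i => rescaled (u i) (mu i) (P i) (Q i)) g ->
  F --> \oo ->
  (fun i => neck_map (u i) (2^-1 * ln (mu i)) 0) @ F --> n ->
  (fun i => neck_map (u i) (2^-1 * ln (mu i)) z) @ F --> n.
Proof.
move=> mu0 cmu cw Foo w0n.
have cwF y : (fun i => rescaled (u i) (mu i) (P i) (Q i) y) @ F --> g y.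
  by move=> A /(cvg_smooth_at (s := [::]) (z := y) cw); exact: Foo.
have sq0 : (fun i => Num.sqrt (mu i)) @ F --> (0 : R).
  rewrite -[X in _ --> X]sqrtr0 => A.
  move=> /(cvg_comp mu (@Num.sqrt R) cmu (@sqrt_continuous R 0)); exact: Foo.
rewrite (_ : (fun i => _) = (fun i => neck_map (u i) (2^-1 * ln (mu i)) 0
  + Num.sqrt (mu i) *: (rescaled (u i) (mu i) (P i) (Q i) z
                        - rescaled (u i) (mu i) (P i) (Q i) 0))); last first.
  by apply/funext => i; exact: neck_mapE.
rewrite -[n]addr0 -(scale0r (g z - g 0)).
by apply: cvgD => //; apply: cvgZ => //; exact: cvgB.
Qed.

(** The rescaled map differs from a map into N by an affine change of values,
    so its derivatives are tangent to N at the corresponding point. *)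
Lemma tangent_rescaled (R : realType) (p : nat) (N : set 'rV[R]_p)
    (u : R * R -> 'rV[R]_p) (lam : R) (P Q : 'rV[R]_p) (s : R) (v : R * R)
    (U : set 'rV[R]_p) (Phi : 'rV[R]_p -> 'rV[R]_p) (j : 'I_p) :
  smooth_on (disk 1) u -> (forall x, disk 1 x -> N (u x)) ->
  s + 2^-1 * ln lam < 0 ->
  open U -> smooth_on U Phi -> (forall y, U y -> N y -> Phi y 0 j = 0) ->
  let w := neck_map u (2^-1 * ln lam) in
  U (w (s, 0)) ->
  'd Phi (w (s, 0)) ('D_v (rescaled u lam P Q) (s, 0)) 0 j = 0.
Proof.
move=> smu uN sk Uo smPhi PhiN w Uw; have inD := ray_in_disk sk.
have du : differentiable u (expR (s + 2^-1 * ln lam), 0) := smu [::] _ inD.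
have Dw := is_diff_neck_map du.
have dPhi : differentiable Phi (w (s, 0)) := smPhi [::] _ Uw.
have DPhi := differentiableP dPhi.
(* Points near (s, 0) still land in the disk, where u takes values in N. *)
have flat : \forall y \near (s, 0), Phi (w y) 0 j = 0.
  have cw : {for (s, 0), continuous w}.
    by apply: differentiable_continuous; exact: ex_diff.
  have nU : \forall y \near (s, 0), U (w y).
    by apply: (cw U); exact: open_nbhs_nbhs.
  have nD : \forall y \near ((s, 0) : R * R), disk 1 (cyl (y.1 + 2^-1 * ln lam, y.2)).
    exact: near_neck_disk.
  by apply: filterS2 nU nD => y Uy Dy; apply: PhiN => //; exact: uN.
have E := diff_flat_coord v Dw DPhi flat.
rewrite (is_diff_deriveE v (is_diff_rescaled P Q Dw)) linearZ mxE.
by apply/eqP; rewrite mulf_eq0; apply/orP; right; apply/eqP.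
Qed.

(** The linear map [T] is the differential of a slice chart at a point where the
    necks accumulate; the vectors that it sends into the first [m] coordinates
    form the tangent space of N there. *)
Lemma tangent_limit (R : realType) (p m : nat) (N : set 'rV[R]_p)
    (u : nat -> R * R -> 'rV[R]_p) (mu : nat -> R) (P Q : nat -> 'rV[R]_p)
    (g : R * R -> 'rV[R]_p) :
  closed_submanifold m N ->
  (forall i, smooth_on (disk 1) (u i)) ->
  (forall i x, disk 1 x -> N (u i x)) ->
  (forall i, 0 < mu i) -> mu @ \oo --> (0 : R) ->
  cvg_smooth setT setT (fun i => rescaled (u i) (mu i) (P i) (Q i)) g ->
  exists2 T : {linear 'rV[R]_p -> 'rV[R]_p}, injective T &
    forall (s : R) (v : R * R) (j : 'I_p), (m <= j)%N ->
      T ('D_v g (s, 0)) 0 j = 0.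
Proof.
move=> [Nc [_ Nsub]] smu uN mu0 cmu cw.
pose y i z := neck_map (u i) (2^-1 * ln (mu i)) z.
(* Convergence along F refines convergence along the sequence. *)
have [F [FU Foo]] := ultraFilterLemma eventually_filter.
have [n [Nn Fn]] : N `&` [set n | y^~ 0 @ F --> n] !=set0.
  move: Nc; rewrite compact_ultra => /(_ _ (ultra_fmap (y^~ 0) FU)); apply.
  apply: Foo; apply: filterS (near_neck_ray 0 mu0 cmu) => i sk.
  apply: uN; rewrite /disk /= enorm2_cyl /=.
  by rewrite -[X in _ < X]expR0 ltr_expR.
have FF : Filter F by exact: ultra_proper.
have [U [V [Phi [Psi [[Uo Un Vo smPhi smPsi] [UV VU PhiN]]]]]] := Nsub n Nn.
have DPhi : is_diff n Phi ('d Phi n).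
  by apply: differentiableP; exact: (smPhi [::] n Un).
exists ('d Phi n).
  have dPsi : differentiable Psi (Phi n) := smPsi [::] _ (UV n Un).1.
  apply: (diff_left_inverse_inj DPhi dPsi).
  have nU : \forall x \near n, U x by exact: open_nbhs_nbhs.
  by apply: filterS nU => x /UV[].
move=> s v j mj.
have Fw : (fun i => 'D_v (rescaled (u i) (mu i) (P i) (Q i)) (s, 0)) @ F -->
    'D_v g (s, 0).
  by move=> A /(cvg_smooth_at (s := [:: v]) (z := (s, 0)) cw); exact: Foo.
have Fy : y^~ (s, 0) @ F --> n := cvg_neck_map (FF := FF) (s, 0) mu0 cmu cw Foo Fn.
have L := cvg_diff (FF := FF) smPhi Uo Un Fy Fw.
have L0 := cvg_comp _ _ L (@coord_continuous R 1 p 0 j _).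
apply: (cvg_unique (@Rhausdorff R) L0).
apply: cvg_trans (@cvg_cst R 0 nat F _); apply: near_eq_cvg.
have FUy : \forall i \near F, U (y i (s, 0)).
  by apply: (Fy U); exact: open_nbhs_nbhs.
have Fray : \forall i \near F, s + 2^-1 * ln (mu i) < 0.
  by apply: Foo; exact: near_neck_ray.
apply: filterS2 FUy Fray => i Uy sk; apply: esym.
have flat x : U x -> N x -> Phi x 0 j = 0 by move=> Ux /(PhiN x Ux); apply.
exact: (@tangent_rescaled R p N (u i) (mu i) (P i) (Q i) s v U Phi j
  (smu i) (uN i) sk Uo smPhi flat Uy).
Qed.

(** The coefficients are combinations of the derivatives at s = 0, ln 2 and
    ln 4, theta = 0. *)
Lemma tangent_coefs (R : realType) (p : nat) (q a b c d : 'rV[R]_p)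
    (T : {linear 'rV[R]_p -> 'rV[R]_p}) (j : 'I_p) :
  (forall s v, T ('D_v (limit_map q a b c d) (s, 0)) 0 j = 0) ->
  [/\ T q 0 j = 0, T a 0 j = 0, T b 0 j = 0, T c 0 j = 0 & T d 0 j = 0].
Proof.
move=> Tj.
have Tx (x : R) : 0 < x -> forall v : R * R,
    v.1 * (T q 0 j + x * T a 0 j - x^-1 * T c 0 j)
    + v.2 * (x * T b 0 j + x^-1 * T d 0 j) = 0.
  move=> x0 v; rewrite -[RHS](Tj (ln x) v).
  rewrite (is_diff_deriveE v (is_diff_limit_map q a b c d (ln x))).
  by rewrite lnK ?posrE// !(linearD, linearN, linearZ) /= !mxE.
have H1 := Tx 1 ltac:(lra) (1, 0); have H2 := Tx 2 ltac:(lra) (1, 0).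
have H4 := Tx 4 ltac:(lra) (1, 0).
have K1 := Tx 1 ltac:(lra) (0, 1); have K2 := Tx 2 ltac:(lra) (0, 1).
by rewrite /= in H1 H2 H4 K1 K2; split; lra.
Qed.

(** * The limit surface *)

Theorem corollary1p5 (R : realType) (p : nat) (N : set 'rV[R]_p)
    (u : nat -> R * R -> 'rV[R]_p) (uinf omega omegat : R * R -> 'rV[R]_p)
    (lam : nat -> R) (delta : R)
    (P Q a b c d : nat -> 'rV[R]_p)
    (pinf qinf ainf binf cinf dinf : 'rV[R]_p) (phi : nat -> nat) :
  closed_submanifold 3 N ->
  (forall i, harmonic_map (disk 1) N (u i)) ->
  (forall i, weakly_conformal (disk 1) (u i)) ->
  (exists M : R, forall i, (energy (disk 1%R) (u i) <= M%:E)%E) ->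
  (* (i) *)
  cvg_smooth (disk 1 `\ (0 : R * R)) (closure (disk 1) `\ (0 : R * R)) u uinf ->
  harmonic_map (disk 1) N uinf ->
  (* (ii) *)
  (forall i, 0 < lam i) -> lam @ \oo --> (0 : R) ->
  harmonic_map setT N omega -> nonconstant_on setT omega ->
  (energy setT omega < +oo)%E ->
  cvg_smooth setT setT (fun i (y : R * R) => u i (lam i *: y)) omega ->
  (* (iii) *)
  only_bubble u lam ->
  (* neck expansion *)
  0 < delta < 1 ->
  neck_expansion u lam delta P Q a b c d ->
  (* coefficients of the limit map *)
  uinf 0 = pinf -> expansion1 uinf pinf ainf binf ->
  smooth_on setT omegat ->
  (forall y, y != 0 -> omegat y = omega (inversion y)) ->
  omegat 0 = pinf -> expansion1 omegat pinf cinf dinf ->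
  subsequence phi ->
  cvg_smooth setT setT
    (fun i => rescaled (u (phi i)) (lam (phi i)) (P (phi i)) (Q (phi i)))
    (limit_map qinf ainf binf cinf dinf) ->
  (enorm ainf ^+ 2 + enorm binf ^+ 2)
    * (enorm cinf ^+ 2 + enorm dinf ^+ 2) != 0 ->
  [/\ [/\ free [:: ainf; binf], free [:: cinf; dinf] &
          <<[:: ainf; binf]>>%VS = <<[:: cinf; dinf]>>%VS],
      qinf = 0 -> opposite_orientation ainf binf cinf dinf &
      qinf <> 0 ->
        (exists2 l : R, 0 < l & ainf = l *: cinf /\ binf = l *: dinf) /\
        catenoid_up_to_similarity (range (limit_map qinf ainf binf cinf dinf))].
Proof.
move=> Nsub harm conf _ _ _ lam0 clam _ _ _ _ _ _ _ _ _ _ _ _ _ phisub cw nz.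
have smu i : smooth_on (disk 1) (u (phi i)) by have [] := harm (phi i).
have uN i x : disk 1 x -> N (u (phi i) x).
  by have [_ + _] := harm (phi i); apply.
have mu0 i : 0 < lam (phi i) by exact: lam0.
have cmu : lam (phi i) @[i --> \oo] --> (0 : R).
  exact: cvg_comp (cvg_subsequence phisub) clam.
have rel := conformal_limit smu (fun i => conf (phi i)) mu0 cmu cw.
have [T Tinj Tg] := tangent_limit Nsub smu uN mu0 cmu cw.
have Tj (j : 'I_p) : (3 <= j)%N -> [/\ T qinf 0 j = 0, T ainf 0 j = 0,
    T binf 0 j = 0, T cinf 0 j = 0 & T dinf 0 j = 0].
  by move=> j3; apply: tangent_coefs => s v; exact: Tg.
have [[aabb ab ccdd cd] _ _ _] := rel.
move: nz; rewrite !enorm_sqr -aabb -ccdd -!mulr2n mulf_eq0 !mulrn_eq0 /=.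
rewrite negb_or => /andP[aa0 cc0].
have a0 : ainf != 0 by apply: contra_neq aa0 => ->; rewrite dot0l.
have fab := conformal_pair_free aa0 aabb ab.
have fcd := conformal_pair_free cc0 ccdd cd.
have [q0|q0] := eqVneq qinf 0.
  rewrite q0 in rel.
  have dep : dependent4 ainf binf cinf dinf.
    by apply: (dependent4_tangent Tinj) => j /Tj[].
  have [cE dE G] := planes_q_eq0 a0 rel dep.
  split=> //; first by split=> //; exact: eq_span_free2 cE dE.
  move=> _; apply: (opposite_orientation_coefs cE dE).
  have A0 : 0 < dot ainf ainf by rewrite lt_neqAle dot_ge0 eq_sym aa0.
  have C0 : 0 < dot cinf cinf by rewrite lt_neqAle dot_ge0 eq_sym cc0.
  have -> : dot ainf cinf / dot ainf ainf * (- dot ainf cinf / dot ainf ainf)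
    - dot ainf dinf / dot ainf ainf * (dot ainf dinf / dot ainf ainf)
    = - (dot cinf cinf / dot ainf ainf).
    have -> : dot cinf cinf =
      (dot ainf cinf ^+ 2 + dot ainf dinf ^+ 2) / dot ainf ainf.
      by rewrite -G mulrC mulKf.
    by field.
  by rewrite oppr_lt0 divr_gt0.
have depc : dependent4 qinf ainf binf cinf.
  by apply: (dependent4_tangent Tinj) => j /Tj[].
have depd : dependent4 qinf ainf binf dinf.
  by apply: (dependent4_tangent Tinj) => j /Tj[].
have [l l0 [aE bE]] := planes_q_neq0 q0 a0 rel depc depd.
have l00 : l != 0 by exact: lt0r_neq0.
have cE : cinf = l^-1 *: ainf + 0 *: binf.
  by rewrite aE scale0r addr0 scalerA mulVf ?scale1r.
have dE : dinf = 0 *: ainf + l^-1 *: binf.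
  by rewrite bE scale0r add0r scalerA mulVf ?scale1r.
split; first by split=> //; exact: eq_span_free2 cE dE.
  by move=> q00; rewrite q00 eqxx in q0.
move=> _; split; first by exists l.
by rewrite aE bE; apply: catenoid_limit_map => //; rewrite -aE -bE.
Qed.
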